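(* For every $k\in\mathbb{N}$ with $k>0$, there exists a $k\times k$ grid in the plane no lattice point of which is visible from the origin; that is, there exist integers $a,b$ such that none of the lattice points $(a+r,b+s)$ with integers $0<r\le k$, $0<s\le k$ is visible from the origin.
   Context: Two distinct integer lattice points $P,Q\in\mathbb{Z}^2$ are said to be visible from each other if the line segment joining $P$ and $Q$ contains no lattice point of $\mathbb{Z}^2$ strictly between $P$ and $Q$. A point is visible from the origin if it is distinct from $(0,0)$ and it and $(0,0)$ are visible from each other. A $k\times k$ grid is a set of lattice points of the form $\{(a+r,b+s): r,s\in\mathbb{Z},\ 0<r\le k,\ 0<s\le k\}$ with $a,b\in\mathbb{Z}$. *)

(* Defs.v *)
(* Stdlib world. *)
From Stdlib Require Import ZArith Reals.

Definition lattice_point : Type := (Z * Z)%type.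

Definition origin : lattice_point := (0%Z, 0%Z).

Definition embed (P : lattice_point) : R * R := (IZR (fst P), IZR (snd P)).

(* The closed segment joining [p] and [q] in the real plane. *)
Definition segment (p q x : R * R) : Prop :=
  exists t : R, (0 <= t <= 1)%R /\
    fst x = ((1 - t) * fst p + t * fst q)%R /\
    snd x = ((1 - t) * snd p + t * snd q)%R.

Definition strictly_between (P Q M : lattice_point) : Prop :=
  segment (embed P) (embed Q) (embed M) /\ M <> P /\ M <> Q.

(* Visibility is a relation between distinct points only; in particular the
   origin is not visible from itself. *)
Definition visible (P Q : lattice_point) : Prop :=
  P <> Q /\ ~ exists M : lattice_point, strictly_between P Q M.

Definition visible_from_origin (P : lattice_point) : Prop := visible P origin.

(* The k x k grid whose lower-left point is (a + 1, b + 1), as a set. *)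
Definition grid (k : nat) (a b : Z) (P : lattice_point) : Prop :=
  exists r s : Z, (0 < r <= Z.of_nat k)%Z /\ (0 < s <= Z.of_nat k)%Z /\
    P = ((a + r)%Z, (b + s)%Z).

(* Main.v *)
Require Import Defs.
From Stdlib Require Import ZArith Reals List Lia Lra.

(** A lattice point whose coordinates share a divisor [d > 1] is not visible
    from the origin: unless it is the origin itself, its quotient by [d] lies
    strictly between it and the origin ([common_divisor_not_visible]).  So it
    is enough to translate the finite set of offsets [(r, s)] by some [(a, b)]
    making the coordinates of every translate non-coprime.

    The Chinese remainder theorem, with one modulus per offset, provides such a
    translation.  Adding the offsets one at a time makes it explicit
    ([exists_translation_with_common_divisors]): if [M] is a multiple of the
    moduli used so far, then [M + 1] is coprime to all of them, and since
    [M = -1] modulo [M + 1], the congruences are solved without computing any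
    modular inverse. *)

Open Scope Z_scope.

Lemma common_divisor_not_visible (d x y : Z) :
  1 < d -> (d | x) -> (d | y) -> ~ visible_from_origin (x, y).
Proof.
  intros Hd [u Hu] [v Hv] [Hne Hno]; subst x y.
  (* The origin is excluded separately: there the quotient is the point itself. *)
  assert (Huv : ~ (u = 0 /\ v = 0)).
  { intros [-> ->]; apply Hne; reflexivity. }
  apply Hno; exists (u, v); split; [|split].
  - assert (HdR : (1 < IZR d)%R) by (apply IZR_lt; exact Hd).
    assert (Hinv : (0 < / IZR d)%R) by (apply Rinv_0_lt_compat; lra).
    assert (Hinv1 : (IZR d * / IZR d = 1)%R) by (apply Rinv_r; lra).
    exists (1 - / IZR d)%R; cbn [embed origin fst snd].
    rewrite !mult_IZR; split; [|split].
    + nra.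
    + field; lra.
    + field; lra.
  - intros E; injection E as Eu Ev; apply Huv; nia.
  - intros E; injection E as Eu Ev; apply Huv; split; assumption.
Qed.

(** The common multiple [M] of the chosen divisors is what drives the
    induction: shifting [a] and [b] by multiples of [M] preserves all the
    divisibilities already obtained. *)
Lemma exists_translation_with_common_divisors (l : list (Z * Z)) :
  exists a b M : Z, 0 < M /\
    forall r s : Z, In (r, s) l ->
      exists d : Z, 1 < d /\ (d | M) /\ (d | a + r) /\ (d | b + s).
Proof.
  induction l as [|[r0 s0] l (a & b & M & HM & IH)].
  - exists 0, 0, 1; split; [lia | intros r s []].
  - (* The shift by [M * (a + r0)] turns [a + r0] into [(a + r0) * (M + 1)]. *)
    exists (a + M * (a + r0)), (b + M * (b + s0)), (M * (M + 1)).
    split; [nia|].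
    intros r s [E | Hin].
    + injection E as <- <-.
      exists (M + 1); split; [lia|]; split; [|split].
      * exists M; ring.
      * exists (a + r0); ring.
      * exists (b + s0); ring.
    + destruct (IH r s Hin) as (d & Hd & [m ->] & [u Hu] & [v Hv]).
      exists d; split; [exact Hd|]; split; [|split].
      * exists (m * (m * d + 1)); ring.
      * exists (u + m * (a + r0)).
        rewrite Z.mul_add_distr_r, <- Hu; ring.
      * exists (v + m * (b + s0)).
        rewrite Z.mul_add_distr_r, <- Hv; ring.
Qed.

Close Scope Z_scope.

Theorem theorem3 : forall k : nat, (0 < k)%nat ->
  exists a b : Z, forall P : lattice_point,
    grid k a b P -> ~ visible_from_origin P.
Proof.
  intros k _.
  set (range := map Z.of_nat (seq 1 k)).
  assert (Hrange : forall z : Z, (0 < z <= Z.of_nat k)%Z -> In z range).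
  { intros z Hz; apply in_map_iff; exists (Z.to_nat z).
    rewrite in_seq; lia. }
  destruct (exists_translation_with_common_divisors (list_prod range range))
    as (a & b & M & _ & H).
  exists a, b; intros P (r & s & Hr & Hs & ->).
  destruct (H r s) as (d & Hd & _ & Hda & Hdb).
  - apply in_prod; apply Hrange; assumption.
  - exact (common_divisor_not_visible d _ _ Hd Hda Hdb).
Qed.
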